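(* Let $n$ be a positive integer. The unrestricted virtual pure braid group $UVP_n$ admits a presentation with generators the elements $\lambda_{k,l}$ for $1\le k\neq l\le n$, and defining relations: $\lambda_{i,j}$ commutes with $\lambda_{k,l}$ if and only if $k\neq j$ or $l\neq i$ (that is, the defining relations are $\lambda_{i,j}\lambda_{k,l}=\lambda_{k,l}\lambda_{i,j}$ for exactly those pairs of generators with $k\neq j$ or $l\neq i$).
   Context: The group of unrestricted virtual braids $UVB_n$ is the group with generators $\sigma_1,\dots,\sigma_{n-1},\rho_1,\dots,\rho_{n-1}$ and defining relations: (R1) $\sigma_i\sigma_{i+1}\sigma_i=\sigma_{i+1}\sigma_i\sigma_{i+1}$ for $1\le i\le n-2$; (R2) $\sigma_i\sigma_j=\sigma_j\sigma_i$ for $|i-j|\ge 2$; (R3) $\rho_i\rho_{i+1}\rho_i=\rho_{i+1}\rho_i\rho_{i+1}$ for $1\le i\le n-2$; (R4) $\rho_i\rho_j=\rho_j\rho_i$ for $|i-j|\ge 2$; (R5) $\rho_i^2=1$ for $1\le i\le n-1$; (R6) $\sigma_i\rho_j=\rho_j\sigma_i$ for $|i-j|\ge 2$; (M) $\rho_i\rho_{i+1}\sigma_i=\sigma_{i+1}\rho_i\rho_{i+1}$ for $1\le i\le n-2$; (F1) $\rho_i\sigma_{i+1}\sigma_i=\sigma_{i+1}\sigma_i\rho_{i+1}$ for $1\le i\le n-2$; (F2) $\rho_{i+1}\sigma_i\sigma_{i+1}=\sigma_i\sigma_{i+1}\rho_i$ for $1\le i\le n-2$. The unrestricted virtual pure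 braid group $UVP_n$ is the kernel of the homomorphism $\nu\colon UVB_n\to S_n$ given by $\nu(\sigma_i)=\nu(\rho_i)=(i,i+1)$ for $1\le i\le n-1$. The elements $\lambda_{k,l}\in UVP_n$ are defined as follows. For $1\le i\le n-1$: $\lambda_{i,i+1}=\rho_i\sigma_i^{-1}$ and $\lambda_{i+1,i}=\rho_i\lambda_{i,i+1}\rho_i=\sigma_i^{-1}\rho_i$. For $1\le i<j-1\le n-1$: $\lambda_{i,j}=\rho_{j-1}\rho_{j-2}\cdots\rho_{i+1}\,\lambda_{i,i+1}\,\rho_{i+1}\cdots\rho_{j-2}\rho_{j-1}$ and $\lambda_{j,i}=\rho_{j-1}\rho_{j-2}\cdots\rho_{i+1}\,\lambda_{i+1,i}\,\rho_{i+1}\cdots\rho_{j-2}\rho_{j-1}$. *)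

(* Defs.v *)
From HB Require Import structures.
From mathcomp Require Import all_fingroup all_boot.
From mathcomp Require Import boolp zify.

Set Implicit Arguments.
Unset Strict Implicit.
Unset Printing Implicit Defensive.

Local Open Scope quotient_scope.
Local Open Scope group_scope.

(* Groups given by generators and relations: words in the letters x and x^-1, *)
(* modulo the least congruence that contains the defining relations and the   *)
(* cancellations x x^-1 = x^-1 x = 1.                                         *)
Section Presented.

Variable X : choiceType.

(* (x, false) is the letter x, and (x, true) is the letter x^-1 *)
Definition letter := (X * bool)%type.
Definition word := seq letter.
HB.instance Definition _ := Choice.on word.

Definition pos (x : X) : letter := (x, false).
Definition flip (a : letter) : letter := (a.1, ~~ a.2).
Definition winv (w : word) : word := rev (map flip w).

(* R u v means that u = v is one of the defining relations *)
Variable R : word -> word -> Prop.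

Inductive pres_eq : word -> word -> Prop :=
| pres_refl u : pres_eq u u
| pres_sym u v : pres_eq u v -> pres_eq v u
| pres_trans u v w : pres_eq u v -> pres_eq v w -> pres_eq u w
| pres_cat u u' v v' :
    pres_eq u u' -> pres_eq v v' -> pres_eq (u ++ v) (u' ++ v')
| pres_cancel a : pres_eq [:: a; flip a] [::]
| pres_rel u v : R u v -> pres_eq u v.

Definition pres_eqb : rel word := fun u v => `[< pres_eq u v >].

Lemma pres_eqb_refl : reflexive pres_eqb.
Proof. by move=> u; apply/asboolP; exact: pres_refl. Qed.

Lemma pres_eqb_sym : symmetric pres_eqb.
Proof. by move=> u v; apply/asboolP/asboolP; exact: pres_sym. Qed.

Lemma pres_eqb_trans : transitive pres_eqb.
Proof.
move=> v u w /asboolP uv /asboolP vw; apply/asboolP; exact: pres_trans uv vw.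
Qed.

Canonical pres_equiv :=
  EquivRel pres_eqb pres_eqb_refl pres_eqb_sym pres_eqb_trans.

Definition presented := {eq_quot pres_equiv}.
HB.instance Definition _ := Choice.on presented.
HB.instance Definition _ := EqQuotient.on presented.

Definition cls (w : word) : presented := \pi_presented w.

Lemma cls_surj (x : presented) : exists w, x = cls w.
Proof. by exists (repr x); rewrite /cls reprK. Qed.

Lemma clsP (u v : word) :
  reflect (pres_eq u v) (cls u == cls v).
Proof. by rewrite /cls eqmodE; exact: asboolP. Qed.

Lemma clsE (u v : word) : pres_eq u v -> cls u = cls v.
Proof. by move=> /clsP/eqP. Qed.

Lemma pres_repr (w : word) : pres_eq (repr (cls w)) w.
Proof. by apply/clsP; rewrite /cls reprK. Qed.

Lemma flipK : involutive flip.
Proof. by case=> x b; rewrite /flip /= negbK. Qed.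

Lemma winvK : involutive winv.
Proof. by move=> w; rewrite /winv map_rev revK mapK //; exact: flipK. Qed.

Lemma winv_cat u v : winv (u ++ v) = winv v ++ winv u.
Proof. by rewrite /winv map_cat rev_cat. Qed.

Lemma pres_mulV w : pres_eq (w ++ winv w) [::].
Proof.
elim: w => [|a w IHw]; first exact: pres_refl.
rewrite -cat1s winv_cat -catA (catA w).
apply: pres_trans (pres_cancel a).
rewrite -[X in pres_eq _ X]/([:: a] ++ ([::] ++ [:: flip a])).
apply: pres_cat; first exact: pres_refl.
by apply: pres_cat => //; exact: pres_refl.
Qed.

Lemma pres_Vmul w : pres_eq (winv w ++ w) [::].
Proof. by have := pres_mulV (winv w); rewrite winvK. Qed.

Lemma pres_winv u v : pres_eq u v -> pres_eq (winv u) (winv v).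
Proof.
move=> uv; have rf := pres_refl.
apply: (@pres_trans _ (winv u ++ (v ++ winv v))).
  rewrite -[X in pres_eq X _]cats0; apply: pres_cat => //.
  by apply: pres_sym; exact: pres_mulV.
apply: (@pres_trans _ ((winv u ++ u) ++ winv v)).
  rewrite catA; apply: pres_cat => //; apply: pres_cat => //.
  exact: pres_sym.
by rewrite -[X in pres_eq _ X]cat0s; apply: pres_cat => //; exact: pres_Vmul.
Qed.

Definition pres_one : presented := cls [::].
Definition pres_mul (x y : presented) : presented :=
  cls (repr x ++ repr y).
Definition pres_inv (x : presented) : presented :=
  cls (winv (repr x)).

Lemma pres_mulE u v :
  pres_mul (cls u) (cls v) = cls (u ++ v).
Proof. by apply: clsE; apply: pres_cat; exact: pres_repr. Qed.

Lemma pres_invE u : pres_inv (cls u) = cls (winv u).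
Proof. by apply: clsE; apply: pres_winv; exact: pres_repr. Qed.

Lemma pres_mulA : associative pres_mul.
Proof.
move=> x y z.
have [[u ->] [v ->] [w ->]] := And3 (cls_surj x) (cls_surj y) (cls_surj z).
by rewrite !pres_mulE catA.
Qed.

Lemma pres_mul1 : left_id pres_one pres_mul.
Proof. by move=> x; have [w ->] := cls_surj x; rewrite pres_mulE. Qed.

Lemma pres_mulr1 : right_id pres_one pres_mul.
Proof. by move=> x; have [w ->] := cls_surj x; rewrite pres_mulE cats0. Qed.

Lemma pres_mulVl : left_inverse pres_one pres_inv pres_mul.
Proof.
move=> x; have [w ->] := cls_surj x; rewrite pres_invE pres_mulE.
by apply: clsE; exact: pres_Vmul.
Qed.

Lemma pres_mulVr : right_inverse pres_one pres_inv pres_mul.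
Proof.
move=> x; have [w ->] := cls_surj x; rewrite pres_invE pres_mulE.
by apply: clsE; exact: pres_mulV.
Qed.

HB.instance Definition _ := isGroup.Build presented
  pres_mulA pres_mul1 pres_mulr1 pres_mulVl pres_mulVr.

Definition gen (x : X) : presented := cls [:: pos x].

Section Lift.

Variables (G : groupType) (f : X -> G).

Definition eval_letter (a : letter) : G := if a.2 then (f a.1)^-1 else f a.1.
Definition eval_word (w : word) : G := \prod_(a <- w) eval_letter a.

Hypothesis fR : forall u v, R u v -> eval_word u = eval_word v.

Lemma eval_pres_eq u v : pres_eq u v -> eval_word u = eval_word v.
Proof.
elim=> {u v} //.
- by move=> u v w _ -> _ ->.
- by move=> u u' v v' _ IHu _ IHv; rewrite /eval_word !big_cat; congr mul.
- case=> x b; rewrite /eval_word !big_cons big_nil /eval_letter /= mulg1.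
  by case: b; rewrite ?mulVg ?mulgV.
Qed.

(* the homomorphism out of the presented group that extends f *)
Definition pres_lift of (forall u v, R u v -> eval_word u = eval_word v) :
  presented -> G := fun x => eval_word (repr x).

Let lift := pres_lift fR.

Lemma pres_liftE w : lift (cls w) = eval_word w.
Proof. exact: eval_pres_eq (pres_repr w). Qed.

Lemma pres_lift_is_monoid_morphism : monoid_morphism lift.
Proof.
split; first by rewrite (pres_liftE [::]) /eval_word big_nil.
move=> x y; have [[u ->] [v ->]] := conj (cls_surj x) (cls_surj y).
by rewrite [LHS](congr1 lift (pres_mulE u v)) !pres_liftE /eval_word big_cat.
Qed.

HB.instance Definition _ :=
  isUMagmaMorphism.Build presented G (pres_lift fR) pres_lift_is_monoid_morphism.

Lemma pres_lift_gen x : lift (gen x) = f x.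
Proof. by rewrite pres_liftE /eval_word big_seq1. Qed.

End Lift.

(* G has the presentation with generators the elements g x and defining       *)
(* relations R: the canonical homomorphism < X | R > -> G is an isomorphism   *)
Definition has_presentation (G : groupType) (g : X -> G) : Prop :=
  exists phi : {multiplicative presented -> G},
    (forall x, phi (gen x) = g x) /\ bijective phi.

End Presented.

Arguments presented {X} R.
Arguments gen {X} R x.
Arguments has_presentation {X} R {G} g.

(* Strands and generators are numbered from 0: strands are the k : 'I_n, and  *)
(* Sigma i, Rho i with i : 'I_n.-1 act on the strands i and i.+1              *)
Variant uvb_gen (n : nat) : Type := Sigma of 'I_n.-1 | Rho of 'I_n.-1.

Definition uvb_gen_code n (x : uvb_gen n) : 'I_n.-1 + 'I_n.-1 :=
  match x with Sigma i => inl i | Rho i => inr i end.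
Definition uvb_gen_decode n (x : 'I_n.-1 + 'I_n.-1) : uvb_gen n :=
  match x with inl i => Sigma i | inr i => Rho i end.
Lemma uvb_gen_codeK n : cancel (@uvb_gen_code n) (@uvb_gen_decode n).
Proof. by case. Qed.
HB.instance Definition _ n :=
  Choice.copy (uvb_gen n) (can_type (@uvb_gen_codeK n)).

Definition far (i j : nat) : bool := (i.+1 < j)%N || (j.+1 < i)%N.

Section Relations.

Variable n : nat.
Implicit Types i j : 'I_n.-1.
Local Notation s i := (pos (Sigma i)).
Local Notation r i := (pos (Rho i)).

Variant uvb_rel : word (uvb_gen n) -> word (uvb_gen n) -> Prop :=
| UVB_R1 i j of j = i.+1 :> nat :
    uvb_rel [:: s i; s j; s i] [:: s j; s i; s j]
| UVB_R2 i j of far i j : uvb_rel [:: s i; s j] [:: s j; s i]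
| UVB_R3 i j of j = i.+1 :> nat :
    uvb_rel [:: r i; r j; r i] [:: r j; r i; r j]
| UVB_R4 i j of far i j : uvb_rel [:: r i; r j] [:: r j; r i]
| UVB_R5 i : uvb_rel [:: r i; r i] [::]
| UVB_R6 i j of far i j : uvb_rel [:: s i; r j] [:: r j; s i]
| UVB_M i j of j = i.+1 :> nat :
    uvb_rel [:: r i; r j; s i] [:: s j; r i; r j]
| UVB_F1 i j of j = i.+1 :> nat :
    uvb_rel [:: r i; s j; s i] [:: s j; s i; r j]
| UVB_F2 i j of j = i.+1 :> nat :
    uvb_rel [:: r j; s i; s j] [:: s i; s j; r i].

End Relations.

Definition UVB (n : nat) : groupType := presented (@uvb_rel n).

Section Nu.

Variable n : nat.

Lemma strand_succ_proof (i : 'I_n.-1) : (i.+1 < n)%N.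
Proof. by case: n i => [[]//|m i]; rewrite ltnS; exact: ltn_ord. Qed.

Definition strand (i : 'I_n.-1) : 'I_n := widen_ord (leq_pred n) i.
Definition strand_succ (i : 'I_n.-1) : 'I_n := Ordinal (strand_succ_proof i).

Definition transp (i : 'I_n.-1) : {perm 'I_n} :=
  tperm (strand i) (strand_succ i).

Definition nu_gen (x : uvb_gen n) : {perm 'I_n} :=
  match x with Sigma i => transp i | Rho i => transp i end.

Lemma transp_braid (i j : 'I_n.-1) : j = i.+1 :> nat ->
  transp i * (transp j * transp i) = transp j * (transp i * transp j).
Proof.
move=> ji; rewrite /transp.
have -> : strand_succ i = strand j by apply: val_inj; rewrite /= ji.
set x := strand i; set y := strand j; set z := strand_succ j.
have xy : x != y by rewrite -val_eqE /= ji neq_ltn ltnSn.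
have xz : x != z by rewrite -val_eqE /= ji neq_ltn ltnS leqnSn.
have yz : y != z by rewrite -val_eqE /= neq_ltn ltnSn.
have e1 : tperm y z ^ tperm x y = tperm x z by rewrite tpermJ tpermR tpermD.
have e2 : tperm x y ^ tperm y z = tperm x z.
  by rewrite tpermJ tpermL tpermD // eq_sym.
by move: e1 e2; rewrite !conjgE !tpermV => -> ->.
Qed.

Lemma transp_far (i j : 'I_n.-1) : far i j ->
  transp i * transp j = transp j * transp i.
Proof.
move=> ij; apply/commgP/conjg_fixP; rewrite /transp tpermJ.
by congr tperm; rewrite tpermD // -val_eqE /=; move: ij; rewrite /far; lia.
Qed.

Lemma nu_genP u v :
  uvb_rel u v -> eval_word nu_gen u = eval_word nu_gen v.
Proof.
case=> *; rewrite /eval_word !big_cons big_nil /eval_letter /= !mulg1;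
  by [exact: transp_braid | exact: transp_far | exact: tperm2
     | symmetry; exact: transp_braid].
Qed.

Definition nu : UVB n -> {perm 'I_n} := pres_lift nu_genP.
HB.instance Definition _ := UMagmaMorphism.on nu.

Lemma nu_sigma i : nu (gen _ (Sigma i)) = transp i.
Proof. exact: pres_lift_gen. Qed.

Lemma nu_rho i : nu (gen _ (Rho i)) = transp i.
Proof. exact: pres_lift_gen. Qed.

Definition ker_nu : pred (UVB n) := fun x => nu x == 1.

Lemma ker_nu_group : group_closed ker_nu.
Proof.
split; first by rewrite unfold_in /ker_nu gmulf1.
move=> x y; rewrite !unfold_in /ker_nu => /eqP x1 /eqP y1.
by rewrite gmulfF /= x1 y1 divgg.
Qed.

Definition UVP : Type := {x : UVB n | ker_nu x}.
HB.instance Definition _ := SubChoice.on UVP.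
HB.instance Definition _ :=
  SubChoice_isSubGroup.Build (UVB n) ker_nu UVP ker_nu_group.

End Nu.

Section Lambda.

Variable n : nat.

(* The generators indexed by natural numbers; the default value 1 for an      *)
(* index m >= n.-1 is never used in the definition of lambda below            *)
Definition sigma (m : nat) : UVB n :=
  if insub m is Some i then gen _ (Sigma i) else 1.
Definition rho (m : nat) : UVB n :=
  if insub m is Some i then gen _ (Rho i) else 1.

Definition lambda_up (i : nat) : UVB n := rho i * (sigma i)^-1.
Definition lambda_down (i : nat) : UVB n := rho i * lambda_up i * rho i.

(* rho_(j-1) ... rho_(i+1) x rho_(i+1) ... rho_(j-1) *)
Definition rho_conj (i j : nat) (x : UVB n) : UVB n :=
  (\prod_(m <- rev (index_iota i.+1 j)) rho m) * x
  * (\prod_(i.+1 <= m < j) rho m).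

Definition lambda_elt (k l : 'I_n) : UVB n :=
  if (k < l)%N then rho_conj k l (lambda_up k) else rho_conj l k (lambda_down l).

Lemma nu_sigma_rho m : nu (sigma m) = nu (rho m).
Proof.
by rewrite /sigma /rho; case: insubP => // i _ _; rewrite nu_sigma nu_rho.
Qed.

Lemma nu_rho2 m : nu (rho m) * nu (rho m) = 1.
Proof.
rewrite /rho; case: insubP => [i _ _|_]; first by rewrite nu_rho tperm2.
by rewrite gmulf1 mulg1.
Qed.

Lemma nu_lambda_up i : nu (lambda_up i) = 1.
Proof. by rewrite gmulfF /= nu_sigma_rho divgg. Qed.

Lemma nu_lambda_down i : nu (lambda_down i) = 1.
Proof. by rewrite 2!gmulfM /= nu_lambda_up mulg1 nu_rho2. Qed.

Lemma nu_rho_conj i j x : nu x = 1 -> nu (rho_conj i j x) = 1.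
Proof.
move=> x1; rewrite /rho_conj !gmulfM /= x1 mulg1.
elim: (index_iota _ _) => [|m s IHs]; first by rewrite !big_nil gmulf1 mulg1.
rewrite rev_cons -cats1 big_cat /= !big_cons big_nil mulg1 !gmulfM /=.
by rewrite -mulgA (mulgA (nu (rho m))) nu_rho2 mul1g.
Qed.

Lemma lambda_ker k l : ker_nu (lambda_elt k l).
Proof.
apply/eqP; rewrite /lambda_elt; case: ifP => _; apply: nu_rho_conj.
- exact: nu_lambda_up.
- exact: nu_lambda_down.
Qed.

(* the index set of the lambda_(k,l): ordered pairs of distinct strands *)
Definition strand_pair := {p : 'I_n * 'I_n | p.1 != p.2}.
HB.instance Definition _ := Choice.on strand_pair.

Definition lambda (p : strand_pair) : UVP n :=
  Sub (lambda_elt (val p).1 (val p).2) (lambda_ker (val p).1 (val p).2).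

(* with p = (i, j) and q = (k, l): k <> j or l <> i *)
Definition lambda_indep (p q : strand_pair) : Prop :=
  (val q).1 <> (val p).2 \/ (val q).2 <> (val p).1.

Variant uvp_rel : word strand_pair -> word strand_pair -> Prop :=
| UVP_comm p q of lambda_indep p q :
    uvp_rel [:: pos p; pos q] [:: pos q; pos p].

End Lambda.

(* Main.v *)
(* Permuting indices lets S_n act on the abstractly presented group A; let P  *)
(* be the semidirect product of S_n and A. Sending rho_i to the transposition *)
(* t_i and sigma_i to lambda_(i,i+1)^-1 t_i defines a homomorphism UVB_n -> P *)
(* whose composite with A -> UVP_n is the inclusion of A, so A -> UVP_n is    *)
(* injective. The map A -> UVP_n exists because conjugation by rho_i permutes *)
(* the indices of the lambda_(k,l), which reduces each commutation to strands *)
(* 0, 1, 2, 3, where it follows from (F1), (F2), (R1), or from the far        *)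
(* relations. The map is surjective because every element of UVB_n is an      *)
(* element of the image times a word in the rho_i, and a word in the rho_i    *)
(* with trivial permutation is trivial (Coxeter presentation of S_n). Finally *)
(* lambda_(i,j) and lambda_(j,i) are separated by a map from A to S_3 killing *)
(* all other generators.                                                      *)
Require Import Defs.
From HB Require Import structures.
From mathcomp Require Import all_fingroup all_boot.
From mathcomp Require Import boolp zify.

Set Implicit Arguments.
Unset Strict Implicit.
Unset Printing Implicit Defensive.

Local Open Scope group_scope.

(** The group A on the proposed generators and relations is right-angled: only the opposite pairs
    (i,j), (j,i) are left unrelated. Since nu is split by rho_i, with image all of S_n, the claim
    amounts to identifying UVB_n with the semidirect product of S_n and A.

    From A to UVB_n: [lambda_elt_rho] says that rho_m permutes the indices of the lambda's, so S_n
    moves any configuration of strands to the first ones. There (R1), (F1), (F2) translate into the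
    three commutations of [lambda_commute3], and (R2), (R6), (R4) into [lambda_commute4]. This gives
    [pure_map].

    From UVB_n to the semidirect product: [uvb_semi], for which the nine relations are checked in
    [semi_gen_rel]. By [uvb_semi_pure] it undoes [pure_map], hence injectivity. Surjectivity
    combines [uvb_factor] with [rho_prod_eq1], the faithfulness of nu on words in the rho_i.
    Noncommutation of opposite pairs is tested in A ([gen_not_commute]) and carried over by
    injectivity. *)

(** * Homomorphisms out of presented groups *)

Section PresentedTheory.

Variables (X : choiceType) (R : word X -> word X -> Prop).

Lemma cls_cat (u v : word X) : cls R (u ++ v) = cls R u * cls R v.
Proof. by rewrite [RHS]pres_mulE. Qed.

Lemma cls_cons (a : letter X) (w : word X) :
  cls R (a :: w) = eval_letter (gen R) a * cls R w.
Proof.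
rewrite -cat1s cls_cat; congr (_ * _); case: a => x [] //.
by rewrite [RHS]pres_invE.
Qed.

Lemma cls_eval (w : word X) : cls R w = eval_word (gen R) w.
Proof.
elim: w => [|a w IHw]; first by rewrite /eval_word big_nil.
by rewrite cls_cons IHw /eval_word big_cons.
Qed.

Lemma gen_rel (u v : word X) :
  R u v -> eval_word (gen R) u = eval_word (gen R) v.
Proof. by move=> uv; rewrite -!cls_eval; apply/clsE/pres_rel. Qed.

Lemma pres_ind (P : presented R -> Prop) :
    P 1 -> (forall x y, P y -> P (gen R x * y)) ->
    (forall x y, P y -> P ((gen R x)^-1 * y)) ->
  forall y, P y.
Proof.
move=> P1 Pg PgV y; have [w ->] := cls_surj y.
elim: w => [//|[x b] w IHw]; rewrite cls_cons /eval_letter /=.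
by case: b; [exact: PgV | exact: Pg].
Qed.

Lemma pres_hom_ext (G : groupType) (f g : presented R -> G) :
    {morph f : x y / x * y} -> {morph g : x y / x * y} ->
  (forall x, f (gen R x) = g (gen R x)) -> f =1 g.
Proof.
have morph1 (h : presented R -> G) : {morph h : x y / x * y} -> h 1 = 1.
  by move=> hM; apply: (mulgI (h 1)); rewrite -hM !mulg1.
move=> fM gM fg; elim/pres_ind => [|x y IHy|x y IHy]; first by rewrite !morph1.
  by rewrite fM gM fg IHy.
apply: (mulgI (f (gen R x))); rewrite -fM mulVKg fg -gM mulVKg.
exact: IHy.
Qed.

End PresentedTheory.

(** * Conjugation by involutions *)

Section Involution.

Variables (G : groupType) (r : G).
Hypothesis r2 : r * r = 1.

Lemma involV : r^-1 = r.
Proof. exact: mulg1_eq. Qed.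

Lemma conj_invol x : x ^ r = r * x * r.
Proof. by rewrite conjgE involV mulgA. Qed.

Lemma conjK_invol x : (x ^ r) ^ r = x.
Proof. by rewrite -conjgM r2 conjg1. Qed.

End Involution.

Lemma commute_conj (G : groupType) (x y z : G) :
  commute (x ^ z) (y ^ z) <-> commute x y.
Proof.
split=> [xy|xy]; last by rewrite /commute -!conjMg xy.
by apply: (conjg_inj z); rewrite !conjMg.
Qed.

(** * The relations of UVB_n, and words in the rho_i *)

Section Strands.

Variable n : nat.
Implicit Types i j k m : nat.

Local Notation rho := (rho n).
Local Notation sigma := (sigma n).

Lemma rho_ord (i : 'I_n.-1) : rho i = gen _ (Rho i).
Proof. by rewrite /Defs.rho valK. Qed.

Lemma sigma_ord (i : 'I_n.-1) : sigma i = gen _ (Sigma i).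
Proof. by rewrite /Defs.sigma valK. Qed.

Lemma rho_out m : ~~ (m < n.-1)%N -> rho m = 1.
Proof. by move=> h; rewrite /Defs.rho insubN. Qed.

Lemma sigma_out m : ~~ (m < n.-1)%N -> sigma m = 1.
Proof. by move=> h; rewrite /Defs.sigma insubN. Qed.

Ltac from_rel h :=
  have := gen_rel h;
  by rewrite /eval_word !big_cons ?big_nil /eval_letter /= ?mulg1
     -?rho_ord -?sigma_ord /= ?mulgA.

Lemma rho2 m : rho m * rho m = 1.
Proof.
(* Outside the range [rho m] takes the default value 1, so this relation, like the far commutations
   below, holds for every natural index. *)
case: (boolP (m < n.-1)%N) => h; last by rewrite rho_out // mulg1.
by from_rel (UVB_R5 (Ordinal h)).
Qed.

Lemma rhoV m : (rho m)^-1 = rho m.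
Proof. exact/involV/rho2. Qed.

Lemma rho_far i j : far i j -> commute (rho i) (rho j).
Proof.
move=> ij; case: (boolP (i < n.-1)%N) => hi; last first.
  by rewrite (rho_out hi); exact/commute_sym/commute1.
case: (boolP (j < n.-1)%N) => hj; last by rewrite (rho_out hj); exact/commute1.
by from_rel (@UVB_R4 n (Ordinal hi) (Ordinal hj) ij).
Qed.

Lemma sigma_rho_far i j : far i j -> commute (sigma i) (rho j).
Proof.
move=> ij; case: (boolP (i < n.-1)%N) => hi; last first.
  by rewrite (sigma_out hi); exact/commute_sym/commute1.
case: (boolP (j < n.-1)%N) => hj; last by rewrite (rho_out hj); exact/commute1.
by from_rel (@UVB_R6 n (Ordinal hi) (Ordinal hj) ij).
Qed.

Lemma sigma_far i j : far i j -> commute (sigma i) (sigma j).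
Proof.
move=> ij; case: (boolP (i < n.-1)%N) => hi; last first.
  by rewrite (sigma_out hi); exact/commute_sym/commute1.
case: (boolP (j < n.-1)%N) => hj; last by rewrite (sigma_out hj); exact/commute1.
by from_rel (@UVB_R2 n (Ordinal hi) (Ordinal hj) ij).
Qed.

Section Adjacent.

Variable i : nat.
(** The bound matters here: for i the last valid index, [rho i.+1] is the default 1 and the braid
    relation would read 1 = rho_i. *)
Hypothesis hi : (i.+1 < n.-1)%N.
Let i0 := Ordinal (ltnW hi).
Let i1 := Ordinal hi.

Lemma rho_braid : rho i * rho i.+1 * rho i = rho i.+1 * rho i * rho i.+1.
Proof. by from_rel (@UVB_R3 n i0 i1 erefl). Qed.

Lemma sigma_braid :
  sigma i * sigma i.+1 * sigma i = sigma i.+1 * sigma i * sigma i.+1.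
Proof. by from_rel (@UVB_R1 n i0 i1 erefl). Qed.

Lemma rho_sigma_mixed :
  rho i * rho i.+1 * sigma i = sigma i.+1 * rho i * rho i.+1.
Proof. by from_rel (@UVB_M n i0 i1 erefl). Qed.

Lemma rho_sigma_F1 :
  rho i * sigma i.+1 * sigma i = sigma i.+1 * sigma i * rho i.+1.
Proof. by from_rel (@UVB_F1 n i0 i1 erefl). Qed.

Lemma rho_sigma_F2 :
  rho i.+1 * sigma i * sigma i.+1 = sigma i * sigma i.+1 * rho i.
Proof. by from_rel (@UVB_F2 n i0 i1 erefl). Qed.

End Adjacent.

Definition swap m k := if k == m then m.+1 else if k == m.+1 then m else k.

Lemma transpE (m : 'I_n.-1) (k : 'I_n) : transp m k = swap m k :> nat.
Proof.
rewrite /swap /transp; case: tpermP => [->|->|/eqP + /eqP]; rewrite -?val_eqE /=.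
- by rewrite eqxx.
- by rewrite eqxx; case: eqP => //; lia.
by move=> /negPf-> /negPf->.
Qed.

Lemma nu_rhoE m (k : 'I_n) : (m < n.-1)%N -> nu (rho m) k = swap m k :> nat.
Proof. by move=> h; rewrite (rho_ord (Ordinal h)) nu_rho transpE. Qed.

Definition rho_prod (w : seq nat) : UVB n := \prod_(m <- w) rho m.

(* rho_k rho_(k-1) ... rho_c, a representative of a right coset of the         *)
(* subgroup generated by rho_0, ..., rho_(k-1) (trivial for c = k + 1).         *)
Definition rho_desc k c : UVB n := rho_prod (rev (index_iota c k.+1)).

Lemma rho_prod_cons m w : rho_prod (m :: w) = rho m * rho_prod w.
Proof. by rewrite /rho_prod big_cons. Qed.

Lemma rho_prod_rcons w m : rho_prod (rcons w m) = rho_prod w * rho m.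
Proof. by rewrite /rho_prod -cats1 big_cat big_seq1. Qed.

Lemma rho_desc0 k : rho_desc k k.+1 = 1.
Proof. by rewrite /rho_desc /index_iota subnn /rho_prod big_nil. Qed.

Lemma rho_descS k c : (c <= k)%N -> rho_desc k c = rho_desc k c.+1 * rho c.
Proof.
move=> ck; rewrite /rho_desc -rho_prod_rcons -rev_cons.
congr (rho_prod (rev _)).
by rewrite /index_iota subSn.
Qed.

Lemma rho_desc_far k c j : (j.+1 < c <= k.+1)%N ->
  commute (rho_desc k c) (rho j).
Proof.
(* Induction on the length d of the descending product, which grows downwards from k. *)
case/andP=> + ck; have {ck} [d ->] : exists d, c = (k.+1 - d)%N.
  by exists (k.+1 - c)%N; lia.
elim: d => [|d IHd] jc.
  by rewrite subn0 rho_desc0; exact/commute_sym/commute1.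
case: (ltnP k d) => kd; first by lia.
rewrite rho_descS; last by lia.
have -> : (k.+1 - d.+1).+1 = (k.+1 - d)%N by lia.
apply/commute_sym/commuteM; first by apply/commute_sym/IHd; lia.
by apply: rho_far; rewrite /far; lia.
Qed.

(** The factors below rho_j commute with rho_(j+1). The braid relation then turns rho_(j+1) rho_j
    rho_(j+1) into rho_j rho_(j+1) rho_j, whose first letter passes the factors above rho_(j+1). *)
Lemma rho_desc_slide k c j : (k < n.-1)%N -> (c <= j < k)%N ->
  rho_desc k c * rho j.+1 = rho j * rho_desc k c.
Proof.
move=> kn /andP[cj jk]; have {cj} [d ->] : exists d, c = (j - d)%N.
  by exists (j - c)%N; lia.
elim: d => [|d IHd].
  rewrite subn0 rho_descS; last by lia.
  rewrite rho_descS //.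
  rewrite -!mulgA [rho j.+1 * _]mulgA -rho_braid ?mulgA; last by lia.
  by congr (_ * _ * _); apply: rho_desc_far; lia.
have [jd|jd] := leqP j d.
  by have -> : (j - d.+1 = j - d)%N by lia.
rewrite rho_descS; last by lia.
have -> : (j - d.+1).+1 = (j - d)%N by lia.
rewrite -mulgA (@rho_far (j - d.+1)); last by rewrite /far; lia.
by rewrite !mulgA IHd.
Qed.

(** Coset enumeration for the Coxeter group: a letter rho_j appended to [rho_desc k c] commutes
    through it (j + 1 < c), extends it (j + 1 = c), cancels its last factor (j = c), or slides
    through as rho_(j-1) (j > c). *)
Lemma rho_prod_normal k w : (k < n.-1)%N -> all (fun m => m <= k)%N w ->
  exists w' c, [/\ all (fun m => m < k)%N w', (c <= k.+1)%N &
                   rho_prod w = rho_prod w' * rho_desc k c].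
Proof.
move=> kn; elim/last_ind: w => [|w j IHw].
  by exists [::], k.+1; split=> //; rewrite rho_desc0 mulg1.
rewrite all_rcons => /andP[jk /IHw[w' [c [w'k ck wE]]]].
rewrite rho_prod_rcons wE -mulgA.
have [jc|cj|jc] := ltngtP j c.
- have [jc'|jc'] := eqVneq j.+1 c.
    exists w', j; split=> //; first exact: leqW.
    by rewrite [rho_desc k j]rho_descS // jc'.
  exists (rcons w' j), c; split=> //; first by rewrite all_rcons w'k andbT /=; lia.
  by rewrite rho_desc_far ?rho_prod_rcons ?mulgA //; lia.
- case: j jk cj => [//|j] jk cj.
  exists (rcons w' j), c; split=> //; first by rewrite all_rcons w'k andbT.
  by rewrite rho_desc_slide ?rho_prod_rcons ?mulgA //; lia.
- exists w', c.+1; split=> //; first by lia.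
  by rewrite jc rho_descS -?mulgA ?rho2 ?mulg1 -?jc.
Qed.

Lemma nu_rho_prod_fix w (x : 'I_n) :
  (x <= n.-1)%N -> all (fun m => m < x.-1)%N w ->
  nu (rho_prod w) x = x.
Proof.
move=> xn; elim: w => [|m w IHw] /=.
  by rewrite /rho_prod big_nil gmulf1 perm1.
case/andP=> mx /IHw fix_x; rewrite rho_prod_cons gmulfM permM.
have -> // : nu (rho m) x = x.
apply: val_inj; rewrite /= nu_rhoE /swap; last by lia.
by do 2?[case: eqP => ? //]; lia.
Qed.

Lemma nu_rho_desc k c (x y : 'I_n) : (k < n.-1)%N -> (c <= k.+1)%N ->
  x = k.+1 :> nat -> y = c :> nat -> nu (rho_desc k c) x = y.
Proof.
move=> kn ck xk; have {ck} [d ->] : exists d, c = (k.+1 - d)%N.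
  by exists (k.+1 - c)%N; lia.
elim: d y => [|d IHd] y yc.
  by rewrite subn0 rho_desc0 gmulf1 perm1; apply: val_inj; rewrite /= xk yc subn0.
case: (ltnP k d) => kd.
  have -> : (k.+1 - d.+1 = k.+1 - d)%N by lia.
  by apply: IHd; lia.
rewrite rho_descS; last by lia.
have cS : (k.+1 - d.+1).+1 = (k.+1 - d)%N by lia.
have cn : (k.+1 - d < n)%N by lia.
rewrite cS gmulfM permM (IHd (Ordinal cn)) //.
apply: val_inj; rewrite /= nu_rhoE /= ?yc /swap; last by lia.
by do 2?[case: eqP => ? //]; lia.
Qed.

(** In the normal form w' [rho_desc k c], the permutation of w' fixes strand k + 1 and that of
    [rho_desc k c] sends it to c. A trivial permutation thus forces c = k + 1, so the coset
    representative is trivial and k decreases. *)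
Lemma rho_prod_eq1 w : all (fun m => m < n.-1)%N w -> nu (rho_prod w) = 1 ->
  rho_prod w = 1.
Proof.
suff gen k : (k <= n.-1)%N -> all (fun m => m < k)%N w ->
    nu (rho_prod w) = 1 -> rho_prod w = 1 by exact: gen.
elim: k w => [|k IHk] w kn wk nu1.
  by case: w wk {nu1} => [|//] _; rewrite /rho_prod big_nil.
have [w' [c [w'k ck wE]]] := rho_prod_normal kn wk.
have xn : (k.+1 < n)%N by lia.
have cn : (c < n)%N by lia.
pose x := Ordinal xn; pose y := Ordinal cn.
have cE : c = k.+1.
  have : nu (rho_prod w) x = x by rewrite nu1 perm1.
  have fix_x : nu (rho_prod w') x = x by exact: nu_rho_prod_fix.
  rewrite wE gmulfM permM /= fix_x.
  by rewrite /= (@nu_rho_desc _ _ _ y) // => /(congr1 val).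
rewrite cE rho_desc0 mulg1 in wE; rewrite wE; apply: IHk => //; first lia.
by rewrite -wE.
Qed.

End Strands.

(** * The rho_m permute the indices of the lambda's *)

Section StrandAction.

Variable n : nat.
Implicit Types i j k l m : nat.

Local Notation rho := (rho n).
Local Notation sigma := (sigma n).

Lemma rho_conjSn i (x : UVB n) : rho_conj i i.+1 x = x.
Proof. by rewrite /rho_conj /index_iota subnn !big_nil mulg1 mul1g. Qed.

Lemma rho_conjS i j (x : UVB n) : (i < j)%N ->
  rho_conj i j.+1 x = rho_conj i j x ^ rho j.
Proof.
move=> ij; rewrite (conj_invol (rho2 n j)) /rho_conj.
rewrite /index_iota subSn // -[(j - i.+1).+1]addn1 iotaD
  rev_cat !big_cat /= subnKC //.
by rewrite !big_seq1 !mulgA.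
Qed.

Section Family.

(** The two hypotheses on [x] are all that the index computations use; both [lambda_up] and
    [lambda_down] satisfy them, so the two orientations are treated at once. *)
Variable x : nat -> UVB n.
Hypothesis x_far : forall i m, far i m -> commute (x i) (rho m).
Hypothesis x_shift : forall i, (i.+1 < n.-1)%N ->
  (x i ^ rho i.+1) ^ rho i = x i.+1.

Local Notation y i j := (rho_conj i j (x i)).

Lemma rho_conj_top i j : (i < j)%N -> y i j ^ rho j = y i j.+1.
Proof. by move=> ij; rewrite rho_conjS. Qed.

Lemma rho_conj_top' i j : (i < j)%N -> y i j.+1 ^ rho j = y i j.
Proof. by move=> ij; rewrite rho_conjS // (conjK_invol (rho2 n j)). Qed.

Lemma conj_commute_step (z : UVB n) j m : far j m ->
  (z ^ rho j) ^ rho m = (z ^ rho m) ^ rho j.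
Proof. by move=> jm; rewrite -!conjgM (rho_far n jm). Qed.

Lemma rho_conj_far i j m : (i < j)%N -> (j < m)%N || (m.+1 < i)%N ->
  y i j ^ rho m = y i j.
Proof.
elim: j => [//|j IHj]; rewrite ltnS leq_eqVlt => /predU1P[<-|ij] far_m.
  by rewrite rho_conjSn; apply/conjg_fixP/commgP/x_far; rewrite /far; lia.
by rewrite rho_conjS // conj_commute_step ?IHj //; rewrite /far; lia.
Qed.

(** For j = m + 2 the braid relation replaces conjugation by rho_m, rho_(m+1), rho_m by rho_(m+1),
    rho_m, rho_(m+1), and rho_(m+1) fixes [y i m]. Later conjugations commute with rho_m. *)
Lemma rho_conj_mid i j m : (i < m)%N -> (m.+1 < j)%N -> (j < n)%N ->
  y i j ^ rho m = y i j.
Proof.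
move=> im; elim: j => [//|j IHj]; rewrite ltnS leq_eqVlt => /predU1P[<-|mj] jn.
  rewrite rho_conjS; last by lia.
  rewrite rho_conjS // -!conjgM mulgA rho_braid; last by lia.
  by rewrite !conjgM rho_conj_far //; lia.
rewrite rho_conjS; last by lia.
by rewrite conj_commute_step ?IHj // /far; lia.
Qed.

Lemma rho_conj_low i j : (i.+1 < j)%N -> (j < n)%N ->
  y i j ^ rho i = y i.+1 j.
Proof.
elim: j => [//|j IHj]; rewrite ltnS leq_eqVlt => /predU1P[<-|ij] jn.
  rewrite rho_conjS // !rho_conjSn x_shift //; lia.
rewrite !rho_conjS //; last by lia.
by rewrite conj_commute_step ?IHj // /far; lia.
Qed.

Lemma rho_conj_low' i j : (i.+1 < j)%N -> (j < n)%N ->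
  y i.+1 j ^ rho i = y i j.
Proof. by move=> ij jn; rewrite -rho_conj_low // (conjK_invol (rho2 n i)). Qed.

(** The excluded case is the only one in which rho_m reverses the order of the two strands, and so
    exchanges [lambda_up] and [lambda_down]. *)
Lemma rho_conj_swap i j m : (i < j)%N -> (j < n)%N -> (m < n.-1)%N ->
  ~~ ((m == i) && (j == i.+1)) ->
  y i j ^ rho m = y (swap m i) (swap m j).
Proof.
move=> ij jn mn; rewrite /swap.
have [mi|mi|mi] := ltngtP m i.
- move=> _; have -> : (j == m) = false by lia.
  have -> : (j == m.+1) = false by lia.
  case: eqP => [->|?]; first by rewrite rho_conj_low' //; lia.
  by rewrite rho_conj_far //; lia.
- move=> _; have -> : (i == m.+1) = false by lia.
  case: eqP => [->|?]; first by rewrite rho_conj_top //; lia.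
  case: eqP => [->|?]; first by rewrite rho_conj_top' //; lia.
  have [jm|mj] := ltnP j m; first by rewrite rho_conj_far ?jm.
  by rewrite rho_conj_mid //; lia.
rewrite mi /= => ji1; have -> : (j == i) = false by lia.
by rewrite (negPf ji1) rho_conj_low //; lia.
Qed.

End Family.

Local Notation up := (lambda_up n).
Local Notation down := (lambda_down n).

Lemma lambda_downE i : down i = up i ^ rho i.
Proof. by rewrite (conj_invol (rho2 n i)). Qed.

Lemma lambda_up_far i m : far i m -> commute (up i) (rho m).
Proof.
move=> im; apply/commute_sym/commuteM; first exact/commute_sym/rho_far.
exact/commuteV/commute_sym/sigma_rho_far.
Qed.

(** The rho factor is shifted by the braid relation (R3), the sigma factor by the mixed relation
    (M). *)
Lemma lambda_up_shift i : (i.+1 < n.-1)%N ->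
  (up i ^ rho i.+1) ^ rho i = up i.+1.
Proof.
move=> hi; rewrite -conjgM /lambda_up conjMg conjVg.
have -> : rho i ^ (rho i.+1 * rho i) = rho i.+1.
  apply: (mulgI (rho i.+1 * rho i)).
  by rewrite -conjgC mulgA rho_braid.
congr (_ * _^-1); apply: (mulgI (rho i.+1 * rho i)); rewrite -conjgC.
have QP : rho i * rho i.+1 * (rho i.+1 * rho i) = 1.
  by rewrite mulgA -(mulgA (rho i)) rho2 mulg1 rho2.
apply: (mulgI (rho i * rho i.+1)).
rewrite (mulgA (rho i * rho i.+1) (rho i.+1 * rho i)) QP mul1g.
by rewrite (mulgA (rho i * rho i.+1)) rho_sigma_mixed // -mulgA -mulgA
  (mulgA (rho i)) QP mulg1.
Qed.

Lemma lambda_down_far i m : far i m -> commute (down i) (rho m).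
Proof.
move=> im; rewrite lambda_downE; apply/commgP/conjg_fixP.
rewrite conj_commute_step //; congr (_ ^ _).
exact/conjg_fixP/commgP/lambda_up_far.
Qed.

Lemma lambda_down_shift i : (i.+1 < n.-1)%N ->
  (down i ^ rho i.+1) ^ rho i = down i.+1.
Proof.
move=> hi; rewrite !lambda_downE -lambda_up_shift // -!conjgM.
by rewrite mulgA rho_braid // !mulgA.
Qed.

Definition lambda_nat k l : UVB n :=
  if (k < l)%N then rho_conj k l (up k) else rho_conj l k (down l).

Lemma lambda_nat_conj k l m :
  (k < n)%N -> (l < n)%N -> (m < n.-1)%N -> k != l ->
  lambda_nat k l ^ rho m = lambda_nat (swap m k) (swap m l).
Proof.
move=> kn ln mn kl; rewrite /lambda_nat; have [kl'|lk] := ltnP k l.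
  have [/andP[/eqP-> /eqP->]|h] := boolP ((m == k) && (l == k.+1)).
    rewrite /swap eqxx; have -> : (k.+1 == k) = false by lia.
    by rewrite eqxx ltnNge leqnSn /= !rho_conjSn -lambda_downE.
  rewrite (rho_conj_swap lambda_up_far lambda_up_shift) //.
  by rewrite ifT // /swap; do 4?[case: eqP => ? //=]; lia.
have {lk kl} lk : (l < k)%N by lia.
have [/andP[/eqP-> /eqP->]|h] := boolP ((m == l) && (k == l.+1)).
  rewrite /swap eqxx; have -> : (l.+1 == l) = false by lia.
  by rewrite eqxx ltnSn !rho_conjSn lambda_downE (conjK_invol (rho2 n l)).
rewrite (rho_conj_swap lambda_down_far lambda_down_shift) //.
by rewrite ifF // /swap; do 4?[case: eqP => ? //=]; lia.
Qed.

Lemma lambda_elt_rho (m : 'I_n.-1) (k l : 'I_n) : k != l ->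
  lambda_elt k l ^ rho m = lambda_elt (transp m k) (transp m l).
Proof. by move=> kl; rewrite [LHS]lambda_nat_conj // /lambda_elt !transpE. Qed.

End StrandAction.

(** * Permutations: transitivity on tuples of distinct points, adjacent transpositions *)

Lemma perm_uniq_seq (T : finType) (s t : seq T) :
  uniq s -> uniq t -> size s = size t -> exists p : {perm T}, map p s = t.
Proof.
elim: s t => [|a s IHs] [|b t] //=; first by exists 1.
case/andP=> as_ us /andP[bt ut] [/(IHs _ us ut)[p pE]].
exists (p * tperm (p a) b); rewrite permM tpermL -pE; congr (_ :: _).
apply/eq_in_map => x xs; rewrite permM tpermD //.
  by apply: contraNneq as_ => /perm_inj->.
by apply: contraNneq bt => ->; rewrite -pE map_f.
Qed.

Section TranspositionInduction.

Variable n : nat.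

Lemma transp_ind (P : {perm 'I_n} -> Prop) :
    P 1 -> (forall s m, P s -> P (s * transp m)) -> forall s, P s.
Proof.
(* [Q s] says that right multiplication by s preserves [P]. It is closed under products, so it is
   enough to reach all transpositions, by induction on the distance of the two points. *)
move=> P1 Pt; pose Q s := forall t, P t -> P (t * s).
have Q1 : Q 1 by move=> t; rewrite mulg1.
have QM s1 s2 : Q s1 -> Q s2 -> Q (s1 * s2).
  by move=> Qs1 Qs2 t /Qs1/Qs2; rewrite mulgA.
have Qadj (i j : 'I_n) : j = i.+1 :> nat -> Q (tperm i j).
  move=> ij t Pt'; have im : (i < n.-1)%N by have := ltn_ord j; lia.
  have -> : tperm i j = transp (Ordinal im); last exact: Pt.
  by congr tperm; apply: val_inj; rewrite /= ?ij.
have Qup d (i j : 'I_n) : j = i + d.+1 :> nat -> Q (tperm i j).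
  elim: d j => [|d IHd] j ij; first by apply: Qadj; rewrite ij addn1.
  have kn : (i + d.+1 < n)%N by have := ltn_ord j; lia.
  pose k := Ordinal kn.
  have -> : tperm i j = tperm i k ^ tperm k j.
    rewrite tpermJ tpermL tpermD // -val_eqE /=; lia.
  rewrite conjgE tpermV; apply: (QM); first by apply: Qadj; rewrite /= ij; lia.
  by apply: QM; [exact: IHd | apply: Qadj; rewrite /= ij; lia].
have Qt (i j : 'I_n) : Q (tperm i j).
  have [ij|ji|/val_inj->] := ltngtP i j; last by rewrite tperm1.
    by apply: (Qup (j - i).-1); lia.
  by rewrite tpermC; apply: (Qup (i - j).-1); lia.
move=> s; suff : Q s by move/(_ 1 P1); rewrite mul1g.
have [ts -> _] := prod_tpermP s.
by elim/big_ind: _ => // -[i j] _; exact: Qt.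
Qed.

End TranspositionInduction.

(** * (F1), (F2) and (R1) as commutations *)

Section BraidCommutation.

(** On strands 0, 1, 2 the elements a, c, b are lambda_(0,1), lambda_(0,2), lambda_(1,2). Moving r0
    and r1 to the right turns each relation into an identity between inverses of a, b, c times the
    same word r0 r1 r0. *)
Variables (G : groupType) (r0 r1 a : G).
Let c := a ^ r1.
Let b := c ^ r0.
Let s0 := a^-1 * r0.
Let s1 := b^-1 * r1.

Hypotheses (r00 : r0 * r0 = 1) (r11 : r1 * r1 = 1).
Hypothesis braid_r : r0 * r1 * r0 = r1 * r0 * r1.

Let slide (r x : G) : r * r = 1 -> r * x = x ^ r * r.
Proof. by move=> rr; rewrite (conj_invol rr) -!mulgA rr mulg1. Qed.

Let r0b : r0 * b^-1 = c^-1 * r0.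
Proof. by rewrite slide // conjVg (conjK_invol r00). Qed.
Let r0c : r0 * c^-1 = b^-1 * r0.
Proof. by rewrite slide // conjVg. Qed.
Let r1a : r1 * a^-1 = c^-1 * r1.
Proof. by rewrite slide // conjVg. Qed.
Let r1c : r1 * c^-1 = a^-1 * r1.
Proof. by rewrite slide // conjVg (conjK_invol r11). Qed.

Let commuteVV (x y : G) : @commute G x^-1 y^-1 -> commute x y.
Proof. by move=> xy; apply: invg_inj; rewrite !invMg xy. Qed.

Let s1s0 : s1 * s0 = b^-1 * c^-1 * (r1 * r0).
Proof. by rewrite /s1 /s0 -!mulgA (mulgA r1) r1a !mulgA. Qed.

Let s0s1 : s0 * s1 = a^-1 * c^-1 * (r0 * r1).
Proof. by rewrite /s1 /s0 -!mulgA (mulgA r0) r0b !mulgA. Qed.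

Lemma commute_of_F1 : r0 * s1 * s0 = s1 * s0 * r1 -> commute c b.
Proof.
rewrite -mulgA s1s0 => F1; apply/commuteVV/(mulIg (r0 * r1 * r0)).
rewrite [in RHS]braid_r; move: F1; rewrite !mulgA r0b -(mulgA _ r0 c^-1) r0c.
by rewrite !mulgA.
Qed.

Lemma commute_of_F2 : r1 * s0 * s1 = s0 * s1 * r0 -> commute a c.
Proof.
rewrite -mulgA s0s1 => F2; apply/commuteVV/(mulIg (r0 * r1 * r0)).
rewrite [in RHS]braid_r; move: F2; rewrite !mulgA r1a -(mulgA _ r1 c^-1) r1c.
by rewrite !mulgA => ->.
Qed.

(* The braid relation for s0, s1 reads a c b = b c a, and c cancels. *)
Lemma commute_of_braid : commute c b -> commute a c ->
  s0 * s1 * s0 = s1 * s0 * s1 -> commute a b.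
Proof.
move=> cb ac; rewrite s0s1 s1s0 /s0 /s1 => R1.
have ac' : @commute G a^-1 c^-1 by apply/commuteV/commute_sym/commuteV/commute_sym.
have cb' : @commute G c^-1 b^-1 by apply/commuteV/commute_sym/commuteV/commute_sym.
have l : r0 * r1 * (a^-1 * r0) = b^-1 * (r0 * r1 * r0).
  by rewrite !mulgA -(mulgA r0) r1a !mulgA r0c.
have r : r1 * r0 * (b^-1 * r1) = a^-1 * (r1 * r0 * r1).
  by rewrite !mulgA -(mulgA r1) r0b !mulgA r1c.
move: R1; rewrite -!mulgA in l r *; rewrite l r.
rewrite (mulgA r1) -braid_r -(mulgA r0) !mulgA => /mulIg/mulIg/mulIg.
rewrite ac' -(mulgA _ a^-1) -cb' -mulgA => /mulgI.
exact: commuteVV.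
Qed.

End BraidCommutation.

(** * The commutations between the lambda's *)

Section LambdaCommute.

Variable n : nat.

Local Notation L := (@lambda_elt n).

Lemma lambda_commute_perm (s : {perm 'I_n}) (i j k l : 'I_n) :
  i != j -> k != l ->
  commute (L (s i) (s j)) (L (s k) (s l)) <-> commute (L i j) (L k l).
Proof.
move=> ij kl; elim/transp_ind: s => [|s m IHs]; first by rewrite !perm1.
rewrite !permM -!lambda_elt_rho ?(inj_eq perm_inj) //.
by rewrite commute_conj.
Qed.

Lemma sigma_lambda_up i : sigma n i = (lambda_up n i)^-1 * rho n i.
Proof. by rewrite /lambda_up invMg invgK -mulgA rhoV rho2 mulg1. Qed.

Lemma lambda_up_adjacent i : (i.+1 < n.-1)%N ->
  let a := lambda_up n i in let b := lambda_up n i.+1 in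
  let c := a ^ rho n i.+1 in
  [/\ commute a c, commute c b & commute a b].
Proof.
move=> hi a b c.
have bE : b = c ^ rho n i by rewrite /b -lambda_up_shift.
have := (sigma_braid hi, rho_sigma_F1 hi, rho_sigma_F2 hi).
rewrite !sigma_lambda_up -/a -/b bE => -[[R1 F1] F2].
have cb := commute_of_F1 (rho2 n _) (rho2 n _) (rho_braid hi) F1.
have ac := commute_of_F2 (rho2 n _) (rho2 n _) (rho_braid hi) F2.
split=> //.
exact: (commute_of_braid (rho2 n _) (rho2 n _) (rho_braid hi) cb ac R1).
Qed.

Lemma lambda_up_far_commute i j : far i j ->
  commute (lambda_up n i) (lambda_up n j).
Proof.
move=> ij; have ji : far j i by move: ij; rewrite /far orbC.
apply: commuteM; first exact: lambda_up_far.
apply/commuteV/commute_sym/commuteM; first exact: sigma_rho_far.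
exact/commuteV/sigma_far.
Qed.

Lemma uniq_size_ord (s : seq 'I_n) : uniq s -> (size s <= n)%N.
Proof. by move/card_uniqP <-; rewrite -[X in (_ <= X)%N]card_ord max_card. Qed.

Lemma lambda_commute3 (i j k : 'I_n) : uniq [:: i; j; k] ->
  [/\ commute (L i j) (L i k), commute (L i k) (L j k) &
      commute (L i j) (L j k)].
Proof.
move=> u; have n3 : (2 < n)%N := uniq_size_ord u.
have n1 : (1 < n)%N := ltnW n3; have n0 : (0 < n)%N := ltnW n1.
pose x := Ordinal n0; pose y := Ordinal n1; pose z := Ordinal n3.
have [s /= [<- <- <-]] := @perm_uniq_seq _ [:: x; y; z] _ erefl u erefl.
have h : (1 < n.-1)%N by lia.
have [ac cb ab] := lambda_up_adjacent h.
have LxyE : L x y = lambda_up n 0 by rewrite /lambda_elt /= rho_conjSn.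
have LyzE : L y z = lambda_up n 1 by rewrite /lambda_elt /= rho_conjSn.
have LxzE : L x z = lambda_up n 0 ^ rho n 1.
  by rewrite /lambda_elt /= rho_conjS // rho_conjSn.
by split; apply/lambda_commute_perm; rewrite ?LxyE ?LyzE ?LxzE.
Qed.

Lemma lambda_commute4 (i j k l : 'I_n) : uniq [:: i; j; k; l] ->
  commute (L i j) (L k l).
Proof.
move=> u; have n3 : (3 < n)%N := uniq_size_ord u; have n2 : (2 < n)%N := ltnW n3.
have n1 : (1 < n)%N := ltnW n2; have n0 : (0 < n)%N := ltnW n1.
have [s /= [<- <- <- <-]] := @perm_uniq_seq _
  [:: Ordinal n0; Ordinal n1; Ordinal n2; Ordinal n3] _ erefl u erefl.
apply/lambda_commute_perm => //; rewrite /lambda_elt /= !rho_conjSn.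
exact: lambda_up_far_commute.
Qed.

Lemma lambda_commute (i j k l : 'I_n) : i != j -> k != l ->
  k != j \/ l != i -> commute (L i j) (L k l).
Proof.
move=> ij kl ind.
have [ik|ik] := eqVneq i k.
  rewrite -{k}ik in kl ind *; have [->//|jl] := eqVneq j l.
  by case: (@lambda_commute3 i j l); rewrite /= ?inE ?negb_or ?ij ?kl ?jl.
have [jl|jl] := eqVneq j l.
  by rewrite -{l}jl in kl ind *;
     case: (@lambda_commute3 i k j); rewrite /= ?inE ?negb_or ?ij ?kl ?ik.
have [jk|jk] := eqVneq j k.
  rewrite -{k}jk in kl ind ik *.
  (* Only here does [ind] exclude something: the opposite pair (i,j), (j,i). *)
  have il : i != l by case: ind; rewrite ?eqxx // eq_sym.
  by case: (@lambda_commute3 i j l); rewrite /= ?inE ?negb_or ?ij ?il ?kl.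
have [il|il] := eqVneq i l.
  rewrite -{l}il in kl ind jl *; apply: commute_sym.
  by case: (@lambda_commute3 k i j);
     rewrite /= ?inE ?negb_or ?kl ?ij // eq_sym jk.
by apply: lambda_commute4; rewrite /= !inE !negb_or ij ik il jk jl kl.
Qed.

End LambdaCommute.

(** * The semidirect product of S_n and the presented group *)

Section Semidirect.

Variable n : nat.
Implicit Types (i j k l : 'I_n) (s t : {perm 'I_n}).

Local Notation A := (presented (@uvp_rel n)).

(** The value 1 on the diagonal makes permutation of indices and commutation hold without assuming i
    and j distinct. *)
Definition pure_gen i j : A := if insub (i, j) is Some p then gen _ p else 1.

Lemma pure_gen_gen (p : strand_pair n) :
  gen _ p = pure_gen (val p).1 (val p).2 :> A.
Proof. by rewrite /pure_gen -surjective_pairing valK. Qed.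

Lemma pure_gen_id i : pure_gen i i = 1.
Proof. by rewrite /pure_gen insubN //= eqxx. Qed.

Lemma pure_gen_commute i j k l : k != j \/ l != i ->
  commute (pure_gen i j) (pure_gen k l).
Proof.
rewrite /pure_gen => ind; case: insubP => [p _ pE|_]; last first.
  exact/commute_sym/commute1.
case: insubP => [q _ qE|_]; last exact: commute1.
have /gen_rel : uvp_rel [:: pos p; pos q] [:: pos q; pos p].
  by apply: UVP_comm; rewrite /lambda_indep pE qE; case: ind => /eqP; [left|right].
by rewrite /eval_word !big_cons big_nil /eval_letter /= !mulg1.
Qed.

Lemma perm_act_rel s (u v : word (strand_pair n)) : uvp_rel u v ->
  eval_word (fun p => pure_gen (s (val p).1) (s (val p).2)) u =
  eval_word (fun p => pure_gen (s (val p).1) (s (val p).2)) v.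
Proof.
case=> p q pq; rewrite /eval_word !big_cons big_nil /eval_letter /= !mulg1.
apply: pure_gen_commute; rewrite !(inj_eq perm_inj).
by case: pq => /eqP; [left|right].
Qed.

Definition perm_act s : A -> A := pres_lift (@perm_act_rel s).
HB.instance Definition _ s := UMagmaMorphism.on (perm_act s).

Lemma perm_act_pure_gen s i j :
  perm_act s (pure_gen i j) = pure_gen (s i) (s j).
Proof.
have [->|ij] := eqVneq i j; first by rewrite !pure_gen_id gmulf1.
rewrite {1}/pure_gen; case: insubP => [p _ pE|/negP[]//].
by rewrite [LHS]pres_lift_gen pE.
Qed.

Lemma perm_act1 a : perm_act 1 a = a.
Proof.
apply: (@pres_hom_ext _ _ _ (perm_act 1) id) => //; first exact: gmulfM.
by move=> p; rewrite pure_gen_gen perm_act_pure_gen !perm1.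
Qed.

Lemma perm_actM s t a : perm_act (s * t) a = perm_act t (perm_act s a).
Proof.
apply: (@pres_hom_ext _ _ _ (perm_act (s * t)) (perm_act t \o perm_act s)).
- exact: gmulfM.
- by move=> x y; rewrite /= !gmulfM.
by move=> p; rewrite /= pure_gen_gen !perm_act_pure_gen !permM.
Qed.

Definition semi : Type := ({perm 'I_n} * A)%type.
HB.instance Definition _ := Choice.on semi.

(* (s, a) stands for the product s a, with a^s = perm_act s a. *)
Definition semi_pair s a : semi := (s, a).

Definition semi_mul (x y : semi) : semi := (x.1 * y.1, perm_act y.1 x.2 * y.2).
Definition semi_one : semi := (1, 1).
Definition semi_inv (x : semi) : semi := (x.1^-1, perm_act x.1^-1 x.2^-1).

Lemma semi_mulA : associative semi_mul.
Proof.
by move=> [s a] [t b] [r c]; rewrite /semi_mul /= perm_actM gmulfM !mulgA.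
Qed.

Lemma semi_mul1 : left_id semi_one semi_mul.
Proof. by move=> [s a]; rewrite /semi_mul /= gmulf1 !mul1g. Qed.

Lemma semi_mulr1 : right_id semi_one semi_mul.
Proof. by move=> [s a]; rewrite /semi_mul /= perm_act1 !mulg1. Qed.

Lemma semi_mulVl : left_inverse semi_one semi_inv semi_mul.
Proof.
move=> [s a]; rewrite /semi_mul /semi_inv /= -perm_actM.
by rewrite !mulVg perm_act1 mulVg.
Qed.

Lemma semi_mulVr : right_inverse semi_one semi_inv semi_mul.
Proof.
by move=> [s a]; rewrite /semi_mul /semi_inv /= mulgV -gmulfM mulgV gmulf1.
Qed.

HB.instance Definition _ := isGroup.Build semi
  semi_mulA semi_mul1 semi_mulr1 semi_mulVl semi_mulVr.

Lemma semi_mulE s t a b :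
  semi_pair s a * semi_pair t b = semi_pair (s * t) (perm_act t a * b).
Proof. by []. Qed.

Lemma semi_invE s a : (semi_pair s a)^-1 = semi_pair s^-1 (perm_act s^-1 a^-1).
Proof. by []. Qed.

Lemma semi_conj s a :
  semi_pair 1 a ^ semi_pair s 1 = semi_pair 1 (perm_act s a).
Proof.
rewrite conjgE semi_invE !semi_mulE.
by rewrite invg1 !gmulf1 !mul1g mulVg mulg1.
Qed.

(** The permutation stands on the left in [semi_pair], so lambda_(i,i+1)^-1 t_i is written t_i
    lambda_(i+1,i)^-1. *)
Definition semi_gen (x : uvb_gen n) : semi :=
  match x with
  | Sigma i => semi_pair (transp i) (pure_gen (strand_succ i) (strand i))^-1
  | Rho i => semi_pair (transp i) 1
  end.

Lemma pure_genV_commute i j k l : k != j \/ l != i ->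
  (pure_gen i j)^-1 * (pure_gen k l)^-1 = (pure_gen k l)^-1 * (pure_gen i j)^-1.
Proof.
move=> ind; rewrite -!invMg; congr (_^-1).
exact/commute_sym/pure_gen_commute.
Qed.

Lemma perm_act_pure_genV s i j :
  perm_act s (pure_gen i j)^-1 = (pure_gen (s i) (s j))^-1.
Proof. by rewrite gmulfV; congr (_^-1); exact: perm_act_pure_gen. Qed.

Lemma transp_adjacent (i j : 'I_n.-1) : j = i.+1 :> nat ->
  let x := strand i in let y := strand j in let z := strand_succ j in
  [/\ strand_succ i = y, uniq [:: x; y; z],
      [/\ transp i x = y, transp i y = x & transp i z = z] &
      [/\ transp j x = x, transp j y = z & transp j z = y]].
Proof.
move=> ij x y z; have iy : strand_succ i = y by apply: val_inj; rewrite /= ij.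
have u : uniq [:: x; y; z] by rewrite /= !inE -!val_eqE /=; lia.
split=> //; split; apply: val_inj;
  by rewrite /= transpE /swap /=; do 2?[case: eqP => ? //=]; lia.
Qed.

Lemma transp_far_fix (i j : 'I_n.-1) : far i j ->
  transp j (strand i) = strand i /\ transp j (strand_succ i) = strand_succ i.
Proof.
rewrite /far => ij; split; apply: val_inj;
  by rewrite /= transpE /swap /=; do 2?[case: eqP => ? //=]; lia.
Qed.

Lemma semi_gen_rel (u v : word (uvb_gen n)) :
  uvb_rel u v -> eval_word semi_gen u = eval_word semi_gen v.
Proof.
have adj_commute (x y z : 'I_n) : uniq [:: x; y; z] ->
    [/\ (pure_gen z y)^-1 * (pure_gen z x)^-1 =
        (pure_gen z x)^-1 * (pure_gen z y)^-1,
        (pure_gen z y)^-1 * (pure_gen y x)^-1 =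
        (pure_gen y x)^-1 * (pure_gen z y)^-1 &
        (pure_gen z x)^-1 * (pure_gen y x)^-1 =
        (pure_gen y x)^-1 * (pure_gen z x)^-1].
  rewrite /= !inE negb_or !andbT => /andP[/andP[xy xz] yz].
  by split; apply: pure_genV_commute; rewrite ?xy ?xz ?(eq_sym _ y) ?yz;
    [left | right | left]; rewrite // eq_sym.
case=> [i j ij|i j ij|i j ij|i j ij|i|i j ij|i j ij|i j ij|i j ij].
all: rewrite /eval_word !big_cons big_nil /eval_letter /= ?mulg1.
all: rewrite !semi_mulE ?gmulf1 ?mul1g ?mulg1.
all: try have tij := transp_braid ij.
all: try have tij := transp_far ij.
all: rewrite ?tij //; congr (semi_pair _ _) => //.
(* For (R1) the pure parts are the same three commuting factors in opposite orders; three exchanges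
   reverse the product. *)
- rewrite ?perm_actM ?perm_act_pure_genV ?permM.
  have [-> /adj_commute[c1 c2 c3] [ix iy iz] [jx jy jz]] := transp_adjacent ij.
  rewrite !(ix, iy, iz, jx, jy, jz) /=.
  by rewrite mulgA c1 -mulgA c2 mulgA c3 -mulgA.
- have ji : far j i by move: ij; rewrite /far orbC.
  have [[ix iy] [jx jy]] := (transp_far_fix ij, transp_far_fix ji).
  rewrite !perm_act_pure_genV ix iy jx jy; apply: pure_genV_commute; left.
  by rewrite -val_eqE /=; move: ij; rewrite /far; lia.
- exact: tperm2.
- by have [ix iy] := transp_far_fix ij; rewrite perm_act_pure_genV ix iy.
- rewrite perm_actM !perm_act_pure_genV.
  have [-> _ [ix iy iz] [jx jy jz]] := transp_adjacent ij.
  by rewrite !(ix, iy, iz, jx, jy, jz).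
- rewrite perm_actM !perm_act_pure_genV.
  have [-> /adj_commute[c1 c2 c3] [ix iy iz] [jx jy jz]] := transp_adjacent ij.
  by rewrite !(ix, iy, iz, jx, jy, jz) /= c3.
- rewrite perm_actM !perm_act_pure_genV.
  have [-> /adj_commute[c1 c2 c3] [ix iy iz] [jx jy jz]] := transp_adjacent ij.
  by rewrite !(ix, iy, iz, jx, jy, jz) /= c1.
Qed.

Definition uvb_semi : UVB n -> semi := pres_lift semi_gen_rel.
HB.instance Definition _ := UMagmaMorphism.on uvb_semi.

Lemma uvb_semi_gen x : uvb_semi (gen _ x) = semi_gen x.
Proof. exact: pres_lift_gen. Qed.

Lemma uvb_semi_lambda_up (m : 'I_n.-1) :
  uvb_semi (lambda_up n m) = semi_pair 1 (pure_gen (strand m) (strand_succ m)).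
Proof.
rewrite gmulfF /= rho_ord sigma_ord !uvb_semi_gen /= semi_invE semi_mulE.
rewrite tpermV tperm2 gmulf1 mul1g invgK perm_act_pure_gen.
by rewrite tpermL tpermR.
Qed.

Lemma uvb_semi_lambda i j : i != j ->
  uvb_semi (lambda_elt i j) = semi_pair 1 (pure_gen i j).
Proof.
move=> ij; have u : uniq [:: i; j] by rewrite /= inE ij.
have n1 : (1 < n)%N := uniq_size_ord u.
have n0 : (0 < n.-1)%N by lia.
pose m := Ordinal n0.
have um : uniq [:: strand m; strand_succ m] by [].
have [s /= [<- <-]] := perm_uniq_seq um u erefl.
elim/transp_ind: s => [|s t IHs].
  by rewrite !perm1 -uvb_semi_lambda_up /lambda_elt /= rho_conjSn.
rewrite !permM -lambda_elt_rho; last by rewrite (inj_eq perm_inj).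
by rewrite gmulfJ /= IHs rho_ord uvb_semi_gen semi_conj perm_act_pure_gen.
Qed.

End Semidirect.

(** * The isomorphism onto UVP_n *)

Section PurePresentation.

Variable n : nat.

Local Notation A := (presented (@uvp_rel n)).

Lemma lambda_rel (u v : word (strand_pair n)) : uvp_rel u v ->
  eval_word (@lambda n) u = eval_word (@lambda n) v.
Proof.
case=> p q pq; rewrite /eval_word !big_cons big_nil /eval_letter /= !mulg1.
apply: val_inj; rewrite !valM /=; apply: lambda_commute.
- exact: (valP p).
- exact: (valP q).
by case: pq => /eqP; [left | right].
Qed.

Definition pure_map : A -> UVP n := pres_lift lambda_rel.
HB.instance Definition _ := UMagmaMorphism.on pure_map.

Lemma pure_map_gen p : pure_map (gen _ p) = lambda p.
Proof. exact: pres_lift_gen. Qed.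

Lemma pure_map_pure_gen (i j : 'I_n) : i != j ->
  val (pure_map (pure_gen i j)) = lambda_elt i j.
Proof.
move=> ij; rewrite /pure_gen; case: insubP => [p _ pE|/negP[]//].
by rewrite pure_map_gen /= pE.
Qed.

Lemma uvb_semi_pure (a : A) : uvb_semi (val (pure_map a)) = semi_pair 1 a.
Proof.
apply: (pres_hom_ext (f := fun a => uvb_semi (val (pure_map a)))
  (g := semi_pair 1)).
- by move=> x y; rewrite !gmulfM.
- by move=> x y; rewrite semi_mulE mulg1 perm_act1.
move=> p; rewrite pure_map_gen /= uvb_semi_lambda ?pure_gen_gen //.
exact: (valP p).
Qed.

Lemma pure_map_inj : injective pure_map.
Proof.
by move=> a b ab; have := uvb_semi_pure a; rewrite ab uvb_semi_pure => -[].
Qed.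

Lemma pure_map_perm_act (m : 'I_n.-1) (a : A) :
  val (pure_map (perm_act (transp m) a)) = val (pure_map a) ^ rho n m.
Proof.
apply: (pres_hom_ext (f := fun a => val (pure_map (perm_act (transp m) a)))
  (g := fun a => val (pure_map a) ^ rho n m)).
- by move=> x y; rewrite !gmulfM.
- by move=> x y; rewrite !gmulfM conjMg.
move=> p; have pP := valP p.
rewrite pure_gen_gen perm_act_pure_gen !pure_map_pure_gen ?(inj_eq perm_inj) //.
by rewrite lambda_elt_rho.
Qed.

(** Such products are stable under left multiplication by the generators and their inverses: rho_m
    passes the pure factor by permuting its indices, and sigma_m is a pure element times rho_m. *)
Lemma uvb_factor (x : UVB n) : exists (a : A) w,
  all (fun m => m < n.-1)%N w /\ x = val (pure_map a) * rho_prod n w.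
Proof.
have rho_mul (m : 'I_n.-1) (a : A) w :
    rho n m * (val (pure_map a) * rho_prod n w) =
    val (pure_map (perm_act (transp m) a)) * rho_prod n (val m :: w).
  rewrite pure_map_perm_act rho_prod_cons (conj_invol (rho2 n m)).
  by rewrite -!mulgA (mulgA (rho n m) (rho n m)) rho2 mul1g.
have step (m : 'I_n.-1) : sigma n m =
    (val (pure_map (pure_gen (strand m) (strand_succ m))))^-1 * rho n m.
  rewrite sigma_lambda_up pure_map_pure_gen /lambda_elt /=.
    by rewrite ltnSn rho_conjSn.
  by rewrite -val_eqE /= neq_ltn ltnSn.
elim/pres_ind: x => [|g y [a [w [wn ->]]]|g y [a [w [wn ->]]]].
- by exists 1, [::]; rewrite /rho_prod big_nil !gmulf1 mulg1.
- case: g => m.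
    rewrite -sigma_ord step -mulgA rho_mul.
    eexists _, (val m :: w); split; first by rewrite /= ltn_ord.
    by rewrite mulgA -!gmulfV -!gmulfM.
  rewrite -rho_ord rho_mul.
  by eexists _, (val m :: w); split; first by rewrite /= ltn_ord.
- case: g => m.
    rewrite -sigma_ord step invMg invgK rhoV -mulgA.
    rewrite (mulgA (val _)) -!gmulfM rho_mul.
    by eexists _, (val m :: w); split; first by rewrite /= ltn_ord.
  rewrite -rho_ord rhoV rho_mul.
  by eexists _, (val m :: w); split; first by rewrite /= ltn_ord.
Qed.

Lemma pure_map_surj (x : UVP n) : exists a, pure_map a = x.
Proof.
have [a [w [wn xE]]] := uvb_factor (val x).
exists a; apply: val_inj; rewrite xE rho_prod_eq1 ?mulg1 //.
have /eqP := valP x; rewrite xE gmulfM /=.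
by have /eqP -> := valP (pure_map a); rewrite mul1g.
Qed.

Lemma pure_map_bij : bijective pure_map.
Proof.
have P x : exists a, pure_map a == x.
  by have [a <-] := pure_map_surj x; exists a.
exists (fun x => xchoose (P x)) => [a|x]; last exact/eqP/(xchooseP (P x)).
exact/pure_map_inj/eqP/(xchooseP (P _)).
Qed.

Lemma gen_not_commute (p q : strand_pair n) :
  ~ lambda_indep p q -> ~ commute (gen (@uvp_rel n) p) (gen _ q).
Proof.
move=> pq; have [q1 q2] : (val q).1 = (val p).2 /\ (val q).2 = (val p).1.
  split; apply/eqP/negPn/negP => /eqP h; apply: pq; by [left | right].
have qp : q != p.
  by apply/eqP => qp; have /eqP := valP p; rewrite -q1 qp.
(* Two noncommuting transpositions for p and q; the relations survive because no relation involves
   the pair p, q. *)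
pose f (r : strand_pair n) : {perm 'I_3} :=
  if r == p then tperm ord0 (lift ord0 ord0)
  else if r == q then tperm (lift ord0 ord0) ord_max else 1.
have fR u v : uvp_rel u v -> eval_word f u = eval_word f v.
  case=> r s rs; rewrite /eval_word !big_cons big_nil /eval_letter /= !mulg1.
  rewrite /f; have [rp|_] := eqVneq r p.
    have [//|_] := eqVneq s p.
    have [sq|_] := eqVneq s q; last by rewrite mulg1 mul1g.
    by case: pq; rewrite -rp -sq.
  have [rq|_] := eqVneq r q; last by rewrite mulg1 mul1g.
  have [sp|_] := eqVneq s p; last first.
    by case: eqVneq => [//|_]; rewrite mulg1 mul1g.
  by case: rs; rewrite sp rq ?q1 ?q2.
move=> /(congr1 (pres_lift fR)).
rewrite !pres_lift_is_monoid_morphism !pres_lift_gen /f !eqxx (negPf qp).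
move/(congr1 (fun s : {perm 'I_3} => s ord0)); rewrite !permM tpermL tpermL.
rewrite (@tpermD _ (lift ord0 ord0) ord_max ord0) // tpermL.
by move/(congr1 val).
Qed.

End PurePresentation.

Theorem theorem2p7 (n : nat) (n_gt0 : (0 < n)%N) :
  has_presentation (@uvp_rel n) (@lambda n) /\
  (forall p q : strand_pair n,
     commute (lambda p) (lambda q) <-> lambda_indep p q).
Proof.
split.
  by exists (@pure_map n); split; [exact: pure_map_gen | exact: pure_map_bij].
move=> p q; split=> [pq|pq].
  apply: contrapT => /gen_not_commute; apply; apply: (@pure_map_inj n).
  by rewrite !gmulfM /= !pure_map_gen.
have : uvp_rel [:: pos p; pos q] [:: pos q; pos p] by constructor.
by move/lambda_rel; rewrite /eval_word !big_cons big_nil /eval_letter /= !mulg1.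
Qed.
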